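(* The group $\mathbb{E}=S/B$ of Eudoxus reals becomes an ordered abelian group if we take the set $P$ of positive elements to comprise all elements $[f]$ for which $f(m)$ takes on infinitely many positive values as $m$ ranges over $\mathbb{N}$.
   Context: A function $f:\mathbb{Z}\to\mathbb{Z}$ is an almost homomorphism iff the function $d_f(p,q)=f(p+q)-f(p)-f(q)$ from $\mathbb{Z}\times\mathbb{Z}$ to $\mathbb{Z}$ has bounded range, i.e. for some integer $C$, $|d_f(p,q)|<C$ for all $p,q\in\mathbb{Z}$. $S$ is the abelian group of all almost homomorphisms $\mathbb{Z}\to\mathbb{Z}$ under pointwise addition, and $B$ is the subgroup of all functions $\mathbb{Z}\to\mathbb{Z}$ with bounded range. The abelian group of Eudoxus reals is the quotient $\mathbb{E}=S/B$; $[f]$ denotes the class of $f\in S$. Here $\mathbb{N}$ denotes the non-negative integers, and membership of $P$ does not depend on the choice of representative. An ordered abelian group is an abelian group $G$ together with a set $P\subseteq G$ of positive elements such that: (1) $0\notin P$; (2) if $x\in P$ and $y\in P$ then $x+y\in P$; (3) if $x$ is any non-zero element of $G$ then either $x$ or $-x$ is a member of $P$. *)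

(* Defs.v *)
From HB Require Import structures.
From mathcomp Require Import all_boot all_order all_algebra.
From mathcomp Require Import boolp classical_sets functions cardinality.
From mathcomp Require Import zify.

Set Implicit Arguments.
Unset Strict Implicit.
Unset Printing Implicit Defensive.

Import Order.TTheory GRing.Theory Num.Theory.
Local Open Scope ring_scope.
Local Open Scope classical_set_scope.
Local Open Scope quotient_scope.

Definition bounded_range (T : Type) (g : T -> int) : Prop :=
  exists C : int, forall x : T, `|g x| < C.

Definition defect (f : int -> int) (pq : int * int) : int :=
  f (pq.1 + pq.2) - f pq.1 - f pq.2.

Definition almost_hom (f : int -> int) : Prop := bounded_range (defect f).

Definition almost_hom_pred : {pred int -> int} := fun f => `[< almost_hom f >].

Lemma bounded_range_zmod (T : Type) (g h : T -> int) :
  bounded_range g -> bounded_range h -> bounded_range (fun x => g x - h x).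
Proof.
move=> [C gC] [D hD]; exists (C + D) => x.
by have := gC x; have := hD x; lia.
Qed.

Lemma almost_hom_zmod_closed : zmod_closed almost_hom_pred.
Proof.
split; first by apply/asboolP; exists 1 => -[p q].
move=> f g /asboolP fS /asboolP gS; apply/asboolP.
have [C hC] := bounded_range_zmod fS gS; exists C => x.
suff -> : defect (f - g) x = defect f x - defect g x by exact: hC.
rewrite /defect; have E p : (f - g) p = f p - g p by [].
by rewrite !E; lia.
Qed.

HB.instance Definition _ :=
  GRing.isZmodClosed.Build (int -> int) almost_hom_pred almost_hom_zmod_closed.

(* S, with pointwise addition inherited from [int -> int] *)
Record almostHom := AlmostHom {
  almostHom_fun :> int -> int;
  almostHom_subproof : almostHom_fun \in almost_hom_pred }.

HB.instance Definition _ := [isSub for almostHom_fun].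
HB.instance Definition _ := [Choice of almostHom by <:].
HB.instance Definition _ := [SubChoice_isSubZmodule of almostHom by <:].

Lemma bounded_range_almost_hom (f : int -> int) :
  bounded_range f -> almost_hom f.
Proof.
move=> [C fC]; exists (C + C + C) => -[p q]; rewrite /defect /=.
by have := fC p; have := fC q; have := fC (p + q); lia.
Qed.

(* B, as a subgroup of S; by [bounded_range_almost_hom] no bounded function
   is lost by restricting to S *)
Definition bounded_pred : {pred almostHom} := fun f => `[< bounded_range f >].

Lemma bounded_zmod_closed : zmod_closed bounded_pred.
Proof.
split; first by apply/asboolP; exists 1 => p.
move=> f g /asboolP fB /asboolP gB; apply/asboolP.
exact: bounded_range_zmod fB gB.
Qed.

HB.instance Definition _ :=
  GRing.isZmodClosed.Build almostHom bounded_pred bounded_zmod_closed.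

Definition eudoxus : zmodType := Quotient.quot bounded_pred.

Definition eudoxus_class (f : almostHom) : eudoxus :=
  \pi_(Quotient.quot bounded_pred) f.

Definition infinitely_many_positive (f : int -> int) : Prop :=
  infinite_set [set y : int | 0 < y /\ exists m : nat, f m%:Z = y].

Definition eudoxus_pos : set eudoxus :=
  [set x | exists f : almostHom,
     x = eudoxus_class f /\ infinitely_many_positive f].

(* The two alternatives in the last clause are not required to be exclusive;
   exclusivity follows from the first two clauses. *)
Definition is_ordered_abelian_group (G : zmodType) (P : set G) : Prop :=
  [/\ ~ P 0,
      forall x y : G, P x -> P y -> P (x + y)
    & forall x : G, x <> 0 -> P x \/ P (- x)].

Lemma eudoxus_class_eq (f g : almostHom) :
  eudoxus_class f = eudoxus_class g <-> bounded_range (fun p => f p - g p).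
Proof.
split=> [/eqP|fg]; last apply/eqP.
  by rewrite -Quotient.idealrBE => /asboolP.
by rewrite -Quotient.idealrBE; apply/asboolP.
Qed.

Lemma infinitely_many_positive_bounded (f g : int -> int) :
  bounded_range (fun p => f p - g p) ->
  infinitely_many_positive f -> infinitely_many_positive g.
Proof.
move=> [C fgC] finf gfin; apply: finf.
have [s gs] : exists s : seq int,
    [set y : int | 0 < y /\ exists m : nat, g m%:Z = y] = [set` s].
  exact/finite_seqP.
pose M : nat := (\sum_(y <- s) `|y|)%N.
have gM m : 0 < g m%:Z -> g m%:Z <= M%:Z.
  move=> gm; have gms : g m%:Z \in s.
    have : [set y : int | 0 < y /\ exists m : nat, g m%:Z = y] (g m%:Z).
      by split=> //; exists m.
    by rewrite gs.
  by rewrite /M (big_rem _ gms) /=; lia.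
apply: (@sub_finite_set _ _ (Posz @` `I_(M + `|C|).+1)); last first.
  exact/finite_image/finite_II.
move=> y [y0 [m fm]]; exists `|y|%N => /=; last by lia.
by have := fgC m%:Z; have := gM m; rewrite fm; lia.
Qed.

(* Membership in [eudoxus_pos] does not depend on the representative. *)
Lemma eudoxus_posE (f : almostHom) :
  eudoxus_pos (eudoxus_class f) <-> infinitely_many_positive f.
Proof.
split=> [[g [/esym/eudoxus_class_eq gf ginf]]|finf]; last by exists f.
exact: infinitely_many_positive_bounded gf ginf.
Qed.

(* Main.v *)
Require Import Defs.
From mathcomp Require Import all_boot all_order all_algebra.
From mathcomp Require Import boolp classical_sets cardinality.
From mathcomp Require Import zify.

(** An integer-valued function takes infinitely many positive values on the
    naturals exactly when it is unbounded above there
    ([infinitely_many_positiveP]).  The content of the theorem is that for an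
    almost homomorphism [f], of defect below [C], this already forces
    [f m --> +oo] ([unbounded_above_tends_to_pinfty]): pick [k] with
    [f k > C]; then [f (m + k) > f m] for every [m], so [f] strictly increases
    along each of the finitely many residue classes modulo [k], hence tends to
    infinity along each of them.

    Tending to infinity, unlike being unbounded above, is visibly preserved by
    sums, which makes the positive elements closed under addition.  For the
    dichotomy, if neither [f] nor [- f] is unbounded above on the naturals then
    [f] is bounded there, and therefore on all integers because [f (- m)]
    differs from [- f m] by a bounded amount
    ([bounded_on_nat_bounded_range]); so [f] represents zero. *)

Set Implicit Arguments.
Unset Strict Implicit.
Unset Printing Implicit Defensive.

Import Order.TTheory GRing.Theory Num.Theory.
Local Open Scope ring_scope.
Local Open Scope classical_set_scope.

Definition unbounded_above (f : int -> int) : Prop :=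
  forall K : nat, exists m : nat, K%:Z < f m%:Z.

Definition tends_to_pinfty (f : int -> int) : Prop :=
  forall K : nat, exists N : nat, forall m : nat, (N <= m)%N -> K%:Z < f m%:Z.

Lemma finite_set_int_ubound (A : set int) :
  finite_set A -> exists M : nat, forall y, A y -> y <= M%:Z.
Proof.
case/finite_seqP=> s ->; exists (\sum_(y <- s) `|y|)%N => y /= ys.
by rewrite (big_rem _ ys) /=; lia.
Qed.

Lemma infinitely_many_positiveP (f : int -> int) :
  infinitely_many_positive f <-> unbounded_above f.
Proof.
split=> [finf K|funb /finite_set_int_ubound[M Mub]].
  apply: contrapT => nK; apply: finf.
  apply: (@sub_finite_set _ _ (Posz @` `I_K.+1)).
    move=> y [y0 [m fm]]; exists `|y|%N => /=; last by lia.
    have : ~ (K%:Z < f m%:Z) by move=> Kf; apply: nK; exists m.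
    by rewrite fm; lia.
  exact/finite_image/finite_II.
have [m Mf] := funb M.
suff : f m%:Z <= M%:Z by lia.
by apply: Mub; split; [lia | exists m].
Qed.

Lemma lower_bound_below (f : int -> int) (k : nat) :
  exists L : nat, forall r : nat, (r < k)%N -> - L%:Z <= f r%:Z.
Proof.
elim: k => [|k [L Lf]]; first by exists 0%N.
exists (L + `|f k%:Z|)%N => r; rewrite ltnS leq_eqVlt => /orP[/eqP ->|rk].
  by lia.
by have := Lf r rk; lia.
Qed.

Lemma increment_tends_to_pinfty (f : int -> int) (k : nat) :
  (0 < k)%N -> (forall m : nat, f m%:Z < f (m + k)%N%:Z) -> tends_to_pinfty f.
Proof.
move=> k0 fk.
have steps (q r : nat) : f r%:Z + q%:Z <= f (r + q * k)%N%:Z.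
  elim: q => [|q IH]; first by rewrite mul0n addn0 addr0.
  have := fk (r + q * k)%N; rewrite mulSn [(k + _)%N]addnC addnA.
  by lia.
have [L Lf] := lower_bound_below f k.
move=> K; exists ((K + L).+1 * k)%N => m.
rewrite -leq_divRL // => qm.
have := steps (m %/ k)%N (m %% k)%N; rewrite addnC -divn_eq.
by have := Lf _ (ltn_pmod m k0); lia.
Qed.

(** This is where the almost homomorphism property is used: a single value
    exceeding the defect bound is enough for a shift to increase [f]. *)
Lemma unbounded_above_tends_to_pinfty (f : int -> int) :
  almost_hom f -> unbounded_above f -> tends_to_pinfty f.
Proof.
move=> [C fC] funb; have [k kf] := funb `|C|%N.
apply: (@increment_tends_to_pinfty f k).
  (* [k] is positive because [defect f (0, 0) = - f 0]. *)
  case: k kf => // kf; have := fC (0%N%:Z, 0%N%:Z).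
  by rewrite /defect /= -PoszD addn0; lia.
by move=> m; have := fC (m%:Z, k%:Z); rewrite /defect /= -PoszD; lia.
Qed.

Lemma tends_to_pinfty_unbounded_above (f : int -> int) :
  tends_to_pinfty f -> unbounded_above f.
Proof. by move=> flim K; have [N Nf] := flim K; exists N; exact: Nf. Qed.

Lemma tends_to_pinftyD (f g : int -> int) :
  tends_to_pinfty f -> tends_to_pinfty g ->
  tends_to_pinfty (fun p => f p + g p).
Proof.
move=> flim glim K; have [N Nf] := flim K; have [N' Ng] := glim 0%N.
exists (maxn N N') => m; rewrite geq_max => /andP[/Nf Kf /Ng g0].
by lia.
Qed.

(** Negative arguments are controlled by the defect at [(m, - m)], which
    compares [f (- m)] with [- f m] up to the constant [f 0]. *)
Lemma bounded_on_nat_bounded_range (f : int -> int) :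
  almost_hom f -> bounded_range (fun m : nat => f m%:Z) -> bounded_range f.
Proof.
move=> [C fC] [D fD]; exists (C + D + D) => x.
have [n xn] : exists n : nat, x = n%:Z \/ x = - n%:Z by exists `|x|%N; lia.
have := fC (n%:Z, - n%:Z); rewrite /defect /= subrr.
have := fD n; have : `|f 0| < D := fD 0%N.
by case: xn => ->; move: (f 0) (f n%:Z) (f (- n%:Z)); lia.
Qed.

Lemma almost_hom_trichotomy (f : int -> int) :
  almost_hom f ->
  [\/ bounded_range f, unbounded_above f | unbounded_above (fun p => - f p)].
Proof.
move=> fS; have [funb|/existsNP[K fK]] := pselect (unbounded_above f).
  by constructor 2.
have [nfunb|/existsNP[L fL]] := pselect (unbounded_above (fun p => - f p)).
  by constructor 3.
constructor 1; apply: bounded_on_nat_bounded_range => //.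
exists (K + L).+1%:Z => m.
have : ~ (K%:Z < f m%:Z) by move=> Kf; apply: fK; exists m.
have : ~ (L%:Z < - f m%:Z) by move=> Lf; apply: fL; exists m.
by lia.
Qed.

Lemma almostHomP (f : almostHom) : almost_hom f.
Proof. by apply/asboolP; exact: almostHom_subproof f. Qed.

Lemma eudoxus_class_surj (x : eudoxus) : exists f, x = eudoxus_class f.
Proof. by exists (repr x); rewrite /eudoxus_class reprK. Qed.

Lemma eudoxus_class0 : eudoxus_class 0 = 0.
Proof. exact: raddf0. Qed.

Lemma eudoxus_classN (f : almostHom) : eudoxus_class (- f) = - eudoxus_class f.
Proof. exact: raddfN. Qed.

Lemma eudoxus_classD (f g : almostHom) :
  eudoxus_class (f + g) = eudoxus_class f + eudoxus_class g.
Proof. exact: raddfD. Qed.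

Lemma eudoxus_pos_unbounded_above (f : almostHom) :
  eudoxus_pos (eudoxus_class f) <-> unbounded_above f.
Proof. by rewrite eudoxus_posE infinitely_many_positiveP. Qed.

Theorem theorem6 : @is_ordered_abelian_group eudoxus eudoxus_pos.
Proof.
split.
- by rewrite -eudoxus_class0 eudoxus_pos_unbounded_above => /(_ 0%N)[].
- move=> x y; have [f ->] := eudoxus_class_surj x.
  have [g ->] := eudoxus_class_surj y.
  rewrite -eudoxus_classD !eudoxus_pos_unbounded_above => funb gunb.
  apply: (@tends_to_pinfty_unbounded_above (f + g : almostHom)).
  apply: tends_to_pinftyD.
    exact: unbounded_above_tends_to_pinfty (almostHomP f) funb.
  exact: unbounded_above_tends_to_pinfty (almostHomP g) gunb.
- move=> x; have [f ->] := eudoxus_class_surj x => f0.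
  rewrite -eudoxus_classN !eudoxus_pos_unbounded_above.
  have [fB||] := almost_hom_trichotomy (almostHomP f); [|by left|by right].
  case: f0; rewrite -eudoxus_class0; apply/eudoxus_class_eq.
  by have [C fC] := fB; exists C => p; rewrite subr0.
Qed.
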